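(* Suppose that $G\in\mathcal{P}$, that $\mu$ is a Borel measure on $(0,1)$, and that $\mathcal{P}_0\subseteq\mathcal{P}$ is a class of distributions such that the expected score $\mathbb{E}_F\,\mathrm{GDS}(\tilde F,Y;G,\mu)$ is finite whenever $F,\tilde F\in\mathcal{P}_0$. (i) The scoring rule $\mathrm{GDS}(\cdot,\cdot\,;G,\mu)$ is proper relative to $\mathcal{P}_0$. (ii) If $\mathcal{P}_0$ contains $G$ and at least one other distinct distribution $F$, then $$\mathbb{E}_G\,\mathrm{GDS}(G,Y;G,\mu)=\mathbb{E}_G\,\mathrm{GDS}(F,Y;G,\mu),$$ and hence $\mathrm{GDS}(\cdot,\cdot\,;G,\mu)$ is not strictly proper relative to $\mathcal{P}_0$. (iii) Suppose that $\mathcal{P}_0$ contains two distinct distributions $F$ and $\tilde F$ such that, for all $\alpha\in(0,1)$, $F^{-1}(\alpha)\le G^{-1}(\alpha)$ if and only if $\tilde F^{-1}(\alpha)\le G^{-1}(\alpha)$. Then $$\mathbb{E}_F\,\mathrm{GDS}(F,Y;G,\mu)=\mathbb{E}_F\,\mathrm{GDS}(\tilde F,Y;G,\mu),$$ and hence $\mathrm{GDS}(\cdot,\cdot\,;G,\mu)$ is not strictly proper relative to $\mathcal{P}_0$.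
   Context: Let $I\subseteq\mathbb{R}$ be an interval. $\mathcal{P}$ is the class of Borel probability measures on $\mathbb{R}$ with mass concentrated in $I$; each $F\in\mathcal{P}$ is identified with its right-continuous CDF. $\mathbb{E}_F h(Y)$ denotes the expectation of $h(Y)$ when $Y$ has distribution $F$. The measure $\mu$ is not necessarily a probability measure. $\mathbf{1}$ denotes the indicator function. For $F\in\mathcal{P}$ and $\alpha\in(0,1)$, $F^{-1}(\alpha)=\min\{z\in\mathbb{R}:F(z)\ge\alpha\}$. For $G\in\mathcal{P}$, $\mathcal{R}(G)=\{\alpha\in(0,1): G(z)=\alpha \text{ for some } z\in\mathbb{R}\}$. For $\alpha\in(0,1)$ and $\theta\in I$, the elementary scoring function is $S_{\alpha,\theta}(x,y)=(\mathbf{1}\{y<x\}-\alpha)(\mathbf{1}\{\theta<x\}-\mathbf{1}\{\theta<y\})$ for $x,y\in I$, i.e. $\alpha$ if $x\le\theta<y$, $1-\alpha$ if $x>\theta\ge y$, and $0$ otherwise. The generalized diagonal score $\mathrm{GDS}(\cdot,\cdot\,;G,\mu):\mathcal{P}\times I\to[0,\infty]$ is $$\mathrm{GDS}(F,y;G,\mu)=\int_{\mathcal{R}(G)}S_{\alpha,G^{-1}(\alpha)}(F^{-1}(\alpha),y)\,\mathrm{d}\mu(\alpha).$$ A (negatively oriented) scoring rule $S$ is proper relative to $\mathcal{P}_0$ if $\mathbb{E}_F S(F,Y)\le\mathbb{E}_F S(\tilde F,Y)$ whenever $F,\tilde F\in\mathcal{P}_0$; it is strictly proper relative to $\mathcal{P}_0$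 if this inequality holds with equality if and only if $\tilde F=F$. *)

(* Defs.v *)
From HB Require Import structures.
From mathcomp Require Import all_boot all_order all_algebra.
From mathcomp Require Import all_classical all_reals all_analysis.

Set Implicit Arguments.
Unset Strict Implicit.
Unset Printing Implicit Defensive.

Import Order.TTheory GRing.Theory Num.Theory.
Import numFieldNormedType.Exports.

Local Open Scope classical_set_scope.
Local Open Scope ring_scope.

Notation distr R := (probability (measurableTypeR R) R).

Definition concentrated (R : realType) (I : interval R) : set (distr R) :=
  [set F : distr R | F [set` I] = 1%E].

Definition idY (R : realType) : measurableTypeR R -> R := idfun.

HB.instance Definition _ (R : realType) :=
  @isMeasurableFun.Build _ _ _ _ (@idY R) (@measurable_id _ _ setT).

Definition CDF (R : realType) (F : distr R) (z : R) : \bar R :=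
  cdf (@idY R : {RV F >-> R}) z.

(* The minimum of [z | F(z) >= a]; it exists for 0 < a < 1 (quantile_min
   below), and the default value 0 is only used for a outside ]0, 1[. *)
Definition quantile (R : realType) (F : distr R) (a : R) : R :=
  let A := [set z : R | (a%:E <= CDF F z)%E] in xget 0 (A `&` lbound A).

Definition cdf_range (R : realType) (G : distr R) : set R :=
  [set a | (0 < a < 1) /\ exists z : R, CDF G z = a%:E].

Definition elem_score (R : realType) (a t x y : R) : R :=
  ((y < x)%R%:R - a) * ((t < x)%R%:R - (t < y)%R%:R).

Definition GDS (R : realType) (G : distr R)
    (mu : {measure set (measurableTypeR R) -> \bar R})
    (F : distr R) (y : R) : \bar R :=
  (\int[mu]_(a in cdf_range G)
     (elem_score a (quantile G a) (quantile F a) y)%:E)%E.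

(* Scores are defined for outcomes in I only, whence the domain of
   integration; F is meant to be concentrated on I. *)
Definition expected_score (R : realType) (I : interval R)
    (S : distr R -> R -> \bar R) (F F' : distr R) : \bar R :=
  (\int[F]_(y in [set` I]) S F' y)%E.

Definition proper_rule (R : realType) (I : interval R)
    (S : distr R -> R -> \bar R) (P0 : set (distr R)) : Prop :=
  forall F F' : distr R, P0 F -> P0 F' ->
    (expected_score I S F F <= expected_score I S F F')%E.

Definition strictly_proper_rule (R : realType) (I : interval R)
    (S : distr R -> R -> \bar R) (P0 : set (distr R)) : Prop :=
  forall F F' : distr R, P0 F -> P0 F' ->
    (expected_score I S F F <= expected_score I S F F')%E /\
    (expected_score I S F F = expected_score I S F F' <-> F' = F).

Lemma quantile_min (R : realType) (F : distr R) (a : R) : 0 < a < 1 ->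
  (a%:E <= CDF F (quantile F a))%E /\
  forall z, (a%:E <= CDF F z)%E -> quantile F a <= z.
Proof.
move=> /andP[a0 a1].
set A := [set z : R | (a%:E <= CDF F z)%E].
have Alt : exists x, (a%:E < CDF F x)%E.
  have H := cvg_cdfy1 (@idY R : {RV F >-> R}).
  have /H : nbhs (1%E : \bar R) [set x | (a%:E < x)%E].
    by apply: open_nbhs_nbhs; split; [exact: open_ereal_gt_ereal|rewrite /= lte_fin].
  case=> M [_ HM]; exists (M + 1); apply: HM => /=; by rewrite ltrDl.
have Agt : exists x, (CDF F x < a%:E)%E.
  have H := cvg_cdfNy0 (@idY R : {RV F >-> R}).
  have /H : nbhs (0%E : \bar R) [set x | (x < a%:E)%E].
    by apply: open_nbhs_nbhs; split; [exact: open_ereal_lt_ereal|rewrite /= lte_fin].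
  case=> M [_ HM]; exists (M - 1); apply: HM => /=; by rewrite gtrDl ltrN10.
have [x xA] := Alt; have [l lA] := Agt.
have nd := cdf_nondecreasing (@idY R : {RV F >-> R}).
have lbA : lbound A l.
  move=> z /= Az; rewrite leNgt; apply/negP => zl.
  have := le_lt_trans (le_trans Az (nd _ _ (ltW zl))) lA.
  by rewrite ltxx.
have hA : has_inf A by split; [exists x; exact: ltW|exists l].
have mA : A (inf A).
  rewrite /A /= leNgt; apply/negP => H.
  have rc := @cdf_right_continuous _ _ _ _ (@idY R : {RV F >-> R}) (inf A).
  have /rc : nbhs (CDF F (inf A)) [set x | (x < a%:E)%E].
    by apply: open_nbhs_nbhs; split; [exact: open_ereal_lt_ereal|].
  case=> e /= e0 He.
  have [z Az zlt] := inf_adherent e0 hA.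
  have zge : inf A <= z by apply: ge_inf => //; exists l.
  have zne : inf A < z.
    rewrite lt_neqAle zge andbT; apply/eqP => E; move: H; rewrite E => /(le_lt_trans Az).
    by rewrite ltxx.
  have := He z; rewrite /= distrC ger0_norm ?subr_ge0// ltrBlDl => /(_ zlt zne) /=.
  by move=> /(le_lt_trans Az); rewrite ltxx.
have : (A `&` lbound A) (inf A) by split=> // z Az; apply: ge_inf => //; exists l.
by move=> /(xgetI 0)[].
Qed.

(* Main.v *)
Require Import Defs.
From HB Require Import structures.
From mathcomp Require Import all_boot all_order all_algebra.
From mathcomp Require Import all_classical all_reals all_analysis.
From mathcomp Require Import measurable_realfun.
From mathcomp Require Import lra.
Import Order.TTheory GRing.Theory Num.Theory.
Import numFieldNormedType.Exports.
Set Implicit Arguments.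
Unset Strict Implicit.
Unset Printing Implicit Defensive.
Local Open Scope classical_set_scope.
Local Open Scope ring_scope.

(** At a fixed level [a], write [t] for the [a]-quantile of [G].  The elementary
score of a report [x] depends on [x] only through the comparison of [x] with
[t], and its expectation under [F] is [a * (1 - F t)] if [x <= t] and
[(1 - a) * F t] otherwise.  As the [a]-quantile of [F] is at most [t] exactly
when [a <= F t], reporting it achieves the smaller of the two values
([risk_min]).  When [F] is [G] and [a] belongs to the range of the CDF of [G],
[G t = a] and the two values coincide ([risk_diag]).  Integrating over [a]
gives propriety and the equality of expected scores under [G].  The equality
for two distributions whose quantiles compare in the same way with those of
[G] is immediate, since they receive the same score at every outcome
([eq_GDS]).

The integration over [a] requires exchanging the integrals against [F] and
[mu], although [mu] need not be sigma-finite.  Here finiteness of the expected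
score helps: almost every outcome has a finite score, and at a fixed level the
score is nonzero on a half-line of outcomes.  Countably many outcomes of
finite score, cofinal and coinitial among all such outcomes
([countable_cofinal], [countable_coinitial]), thus detect every level that
matters, and they show that [mu] is sigma-finite where the scores do not
vanish; Tonelli's theorem then applies ([tonelli_countable],
[integrated_score_Fubini]). *)

(** * Tonelli's theorem against an arbitrary measure *)

Section TonelliCountable.
Local Open Scope ereal_scope.
Context d1 d2 (X : measurableType d1) (Y : measurableType d2) (R : realType).

(** The restriction of [mu] to the union of the supports of countably many
nonnegative integrable functions is sigma-finite: the pieces are the level
sets [f n >= 1 / (k + 1)], joined with the complement of [E], which is null
for the restriction. *)
Lemma sigma_finite_support_countable (mu : {measure set X -> \bar R})
    (f : nat -> X -> \bar R) (E := \bigcup_n [set x | f n x != 0])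
    (mE : measurable E) :
  (forall n, measurable_fun setT (f n)) -> (forall n x, 0 <= f n x) ->
  (forall n, \int[mu]_x f n x < +oo) ->
  sigma_finite setT (mrestr mu mE).
Proof.
move=> mf f0 foo.
pose L n k := [set x | (k.+1%:R^-1)%:E <= f n x].
have mL n k : measurable (L n k).
  by rewrite -[L n k]setTI; exact: emeasurable_fun_c_infty.
have Loo n k : mu (L n k) < +oo.
  have k0 : (0 < k.+1%:R^-1 :> R)%R by rewrite invr_gt0 ltr0n.
  have : (k.+1%:R^-1)%:E * mu (L n k) < +oo.
    apply: le_lt_trans (foo n).
    rewrite -integral_cst//.
    apply: (@le_trans _ _ (\int[mu]_(x in L n k) f n x)).
      apply: ge0_le_integral => //.
      - by move=> x _; rewrite lee_fin ltW.
      - exact: measurable_funTS.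
    exact: ge0_subset_integral.
  move: (measure_ge0 mu (L n k)); case: (mu (L n k)) => // [r _ _|_].
    exact: ltry.
  by rewrite gt0_muley.
exists (fun i => let p := odflt (0%N, 0%N) (unpickle i) in ~` E `|` L p.1 p.2).
  apply/esym; rewrite -subTset => x _.
  have [[n _ /= fnx]|nEx] := pselect (E x); last by exists 0%N => //; left.
  have [k fk] : exists k, (k.+1%:R^-1)%:E <= f n x.
    move: (f0 n x) fnx; case: (f n x) => // [r|_ _].
    - rewrite lee_fin eqe => r0 rn0; have rp : (0 < r)%R by rewrite lt_neqAle eq_sym rn0.
      exists (Num.truncn r^-1); rewrite lee_fin -[leRHS]invrK lef_pV2 ?posrE ?invr_gt0//.
      by exact/ltW/truncnS_gt.
    - by exists 0%N; rewrite leey.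
  by exists (pickle (n, k)) => //=; rewrite pickleK; right.
move=> i; set p := odflt _ _; split.
  by apply: measurableU; [exact: measurableC|exact: mL].
rewrite /mrestr setIUl setICl set0U; apply: le_lt_trans (Loo p.1 p.2).
by rewrite le_measure ?inE//; exact: measurableI.
Qed.

(** Tonelli without sigma-finiteness of [mu]: it suffices that, up to a
[nu]-null set of ordinates, the support of every horizontal section of [h] is
covered by the supports of countably many [mu]-integrable ones.  Measurability
of the partial integral against [mu] is no longer automatic and has to be
assumed. *)
Lemma tonelli_countable (mu : {measure set X -> \bar R})
    (nu : {sigma_finite_measure set Y -> \bar R}) (h : X * Y -> \bar R)
    (N : set Y) (u : nat -> Y) :
  measurable_fun setT h -> (forall p, 0 <= h p) ->
  measurable_fun setT (fun y => \int[mu]_x h (x, y)) ->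
  measurable N -> nu N = 0 ->
  (forall n, \int[mu]_x h (x, u n) < +oo) ->
  (forall x y, ~ N y -> h (x, y) != 0 -> exists n, h (x, u n) != 0) ->
  \int[nu]_y \int[mu]_x h (x, y) = \int[mu]_x \int[nu]_y h (x, y).
Proof.
move=> mh h0 mH mN N0 uoo hu.
have msec1 y : measurable_fun setT (fun x => h (x, y)).
  by apply: measurableT_comp => //; exact: pair2_measurable.
have msec2 x : measurable_fun setT (fun y => h (x, y)).
  by apply: measurableT_comp => //; exact: pair1_measurable.
pose E := \bigcup_n [set x | h (x, u n) != 0].
have mE : measurable E.
  apply: bigcup_measurable => n _; rewrite -[X in measurable X]setTI.
  exact: emeasurable_neq.
have sf : sigma_finite setT (mrestr mu mE).
  by exact: (@sigma_finite_support_countable mu (fun n x => h (x, u n))).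
(* [muE] is the restriction of [mu] to [E], with its sigma-finite structure *)
pose fact := Measure_isSigmaFinite.Build _ _ _ (mrestr mu mE) sf.
pose muE : {sigma_finite_measure set X -> \bar R} :=
  HB.pack_for (SigmaFiniteMeasure.type X R) (mrestr mu mE) fact.
pose k := h \_ (E `*` setT).
have mk : measurable_fun setT k.
  by apply/(measurable_restrictT _ _).1; [exact: measurableX|exact: measurable_funTS].
have k0 p : 0 <= k p by rewrite /k erestrict_ge0.
have kE x y : k (x, y) = ((fun x => h (x, y)) \_ E) x.
  rewrite /k !patchE; have -> : ((x, y) \in E `*` setT) = (x \in E) => //.
  by apply/idP/idP => /set_mem; [move=> [Ex _]|move=> Ex]; apply/mem_set.
have sub0 x y : ~ E x -> k (x, y) = 0.
  by move=> nE; rewrite kE patchE; case: ifPn => // /set_mem.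
have hkE x y : E x -> k (x, y) = h (x, y).
  by move=> Ex; rewrite kE patchE mem_set.
(* [mu] and [muE] integrate alike the functions vanishing outside [E] *)
have intE (g : X -> \bar R) : (forall x, ~ E x -> g x = 0) ->
    \int[mu]_x g x = \int[muE]_x g x.
  move=> g0; have -> : g = g \_ E.
    apply/funext => x; rewrite patchE; case: ifPn => // /negP nE.
    by apply: g0 => Ex; exact/nE/mem_set.
  rewrite -!integral_mkcond; apply: eq_measure_integral => A mA AE.
  by rewrite /muE/= /mrestr setIidl.
have hk x y : ~ N y -> h (x, y) = k (x, y).
  move=> Ny; have [Ex|nEx] := pselect (E x); first by rewrite hkE.
  rewrite sub0//; apply/eqP/negPn/negP => /(hu _ _ Ny)[n hn].
  by apply: nEx; exists n.
have aeN : {ae nu, forall y, ~ N y}.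
  exists N; split => //.
  by move=> y /= /contrapT.
transitivity (\int[nu]_y \int[mu]_x k (x, y)).
  apply: ge0_ae_eq_integral => //.
  - rewrite (_ : (fun y => _) = fun y => \int[muE]_x k (x, y)).
      exact: measurable_fun_fubini_tonelli_G.
    by apply/funext => y; apply: intE => x; exact: sub0.
  - by move=> y _; exact: integral_ge0.
  - by move=> y _; exact: integral_ge0.
  - by apply: filterS aeN => y Ny _; apply: eq_integral => x _; exact: hk.
transitivity (\int[muE]_x \int[nu]_y k (x, y)).
  rewrite (fubini_tonelli (m1 := muE))//.
  by apply: eq_integral => y _; apply: intE => x; exact: sub0.
rewrite -intE; last by move=> x nEx; apply: integral0_eq => y _; exact: sub0.
apply: eq_integral => x _; apply: ge0_ae_eq_integral => //.
- by apply: measurableT_comp => //; exact: pair1_measurable.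
- by apply: filterS aeN => y Ny _; rewrite hk.
Qed.
End TonelliCountable.

(** * Countable cofinal subsets of the line *)

(** Unless [A] has a maximum, pick for each rational [q] a point of [A] above [q]
when there is one. *)
Lemma countable_cofinal (R : realType) (A : set R) : A !=set0 ->
  exists u : nat -> R, (forall n, A (u n)) /\
    forall y, A y -> exists n, y <= u n.
Proof.
move=> [y0 Ay0].
have [[m [Am mA]]|nomax] := pselect (exists m, A m /\ ubound A m).
  by exists (fun=> m); split => // y /mA ym; exists 0%N.
pose u n := xget y0 [set y | A y /\ ratr (odflt 0 (unpickle n) : rat) <= y].
exists u; split => [n|y Ay]; first by rewrite /u; case: xgetP => // y _ [].
(* a rational between y and a larger point of A gives the index *)
have [z Az yz] : exists2 z, A z & y < z.
  apply: contrapT => H; apply: nomax; exists y; split => // z Az.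
  by rewrite leNgt; apply/negP => yz; apply: H; exists z.
have [q /[!in_itv]/= /andP[yq qz]] := rat_in_itvoo yz.
exists (pickle q); rewrite /u pickleK /=.
case: xgetP => [w _ [_ qw]|/(_ z)[]]; first exact: ltW (lt_le_trans yq qw).
by split => //; exact: ltW.
Qed.

Lemma countable_coinitial (R : realType) (A : set R) : A !=set0 ->
  exists u : nat -> R, (forall n, A (u n)) /\
    forall y, A y -> exists n, u n <= y.
Proof.
move=> A0; have [|v [vA vcof]] := @countable_cofinal R (-%R @` A).
  by case: A0 => a Aa; exists (- a), a.
exists (fun n => - v n); split => [n|y Ay].
  by have [a Aa <-] := vA n; rewrite opprK.
by have [|n] := vcof (- y); [exists y|exists n; rewrite lerNl].
Qed.

(** * Quantile functions *)

Section Quantile.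
Context {R : realType}.
Implicit Types (F G : distr R) (a b z : R).

Lemma CDF_nondecreasing F : nondecreasing_fun (CDF F).
Proof. exact: cdf_nondecreasing. Qed.

Lemma quantile_le F a z : 0 < a < 1 ->
  (quantile F a <= z) = (a%:E <= CDF F z)%E.
Proof.
move=> a01; have [aq minq] := quantile_min F a01.
by apply/idP/idP => [qz|/minq//]; apply: le_trans aq _; exact: CDF_nondecreasing.
Qed.

Lemma quantile_nondecreasing F a b : 0 < a < 1 -> 0 < b < 1 -> a <= b ->
  quantile F a <= quantile F b.
Proof.
move=> a01 b01 ab; rewrite quantile_le//.
by apply: le_trans (proj1 (quantile_min F b01)); rewrite lee_fin.
Qed.

Lemma measurable_quantile F :
  measurable_fun (`]0, 1[ : set (measurableTypeR R)) (quantile F).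
Proof.
move=> mD; apply: (measurability (@RGenCInfty.G R)) mD => [|/= _ [_] [r] -> <-].
  exact: RGenCInfty.measurableE.
apply: is_interval_measurable => s t/=.
rewrite !in_itv/= !andbT => -[s01 fs] [t01 ft] u /andP[su ut].
have u01 : 0 < u < 1.
  by case/andP: s01 t01 => s0 _ /andP[_ t1]; rewrite (lt_le_trans s0)//= (le_lt_trans ut).
by rewrite !in_itv/= andbT; split => //; rewrite (le_trans fs)// quantile_nondecreasing.
Qed.

Lemma cdf_range_sub G a : cdf_range G a -> 0 < a < 1.
Proof. by case. Qed.

(** On [cdf_range G] the quantile function is a right inverse of the CDF. *)
Lemma CDF_quantile G a : cdf_range G a -> CDF G (quantile G a) = a%:E.
Proof.
move=> [a01 [z Gz]]; have [aq minq] := quantile_min G a01.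
apply/eqP; rewrite eq_le aq andbT -Gz; apply: CDF_nondecreasing.
by apply: minq; rewrite Gz.
Qed.

Lemma CDF_fin_num F z : CDF F z \is a fin_num.
Proof. exact: fin_num_measure. Qed.

Lemma measurable_CDF_quantile F G :
  measurable_fun (`]0, 1[ : set (measurableTypeR R))
    (fun a => fine (CDF F (quantile G a))).
Proof.
have mF : measurable_fun (setT : set (measurableTypeR R)) (fine \o CDF F).
  by apply: measurableT_comp; [exact: fine_measurable|exact: cdf_measurable].
by apply: (measurable_comp _ _ mF) => //; exact: measurable_quantile.
Qed.

(** [cdf_range G] is where the measurable functions [CDF G \o quantile G] and
the identity agree on ]0, 1[. *)
Lemma measurable_cdf_range G :
  measurable (cdf_range G : set (measurableTypeR R)).
Proof.
rewrite (_ : cdf_range G = `]0, 1[ `&`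
    (fun a => fine (CDF G (quantile G a)) == a) @^-1` [set true]).
  suff m : measurable_fun (`]0, 1[ : set (measurableTypeR R))
      (fun a => fine (CDF G (quantile G a)) == a) by exact: m.
  by apply: measurable_fun_eqr => //; exact: measurable_CDF_quantile.
apply/seteqP; split => a /=.
  by move=> aG; rewrite in_itv/= (cdf_range_sub aG) CDF_quantile//= eqxx.
rewrite in_itv/= => -[a01 /eqP aE]; split => //; exists (quantile G a).
by rewrite -[in RHS]aE fineK// CDF_fin_num.
Qed.

End Quantile.

(** * The elementary score *)

Section Score.
Context {R : realType}.
Implicit Types a t x y : R.

Lemma elem_scoreE a t x y : elem_score a t x y =
  if x <= t then a * (t < y)%R%:R else (1 - a) * (y <= t)%R%:R.
Proof.
rewrite /elem_score; have [xt|tx] := leP x t.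
  rewrite sub0r; have [ty|yt] := ltP t y; last by rewrite oppr0 !mulr0.
  by rewrite ltNge (le_trans xt (ltW ty))/= sub0r mulrNN.
have [yt|ty] := leP y t; last by rewrite subrr !mulr0.
by rewrite (le_lt_trans yt tx) subr0.
Qed.

Lemma elem_score_ge0 a t x y : 0 < a < 1 -> 0 <= elem_score a t x y.
Proof.
move=> /andP[a0 a1]; rewrite elem_scoreE.
by case: ifP => _; rewrite mulr_ge0// ?ltW// subr_gt0.
Qed.

(** If [Y] falls below [t] with probability [c], the expected elementary score
of a report [x] is [a * (1 - c)] when [x <= t] and [(1 - a) * c] otherwise;
the smaller of the two is reached by the report that is at most [t] exactly
when [a <= c]. *)
Lemma elem_score_opt a t x x' c : (x <= t) = (a <= c) ->
  (if x <= t then a * (1 - c) else (1 - a) * c) <=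
  (if x' <= t then a * (1 - c) else (1 - a) * c).
Proof. by move=> ->; case: (leP a c) => ac; case: (leP x' t) => _ //; lra. Qed.

Lemma measurable_natbool d (T : measurableType d) (D : set T) (b : T -> bool) :
  measurable_fun D b -> measurable_fun D (fun i => (b i)%:R : R).
Proof.
move=> mb; rewrite (_ : (fun _ => _) = fun i => if b i then 1 else 0 : R).
  move=> mD.
  apply: (measurable_fun_if mD mb) => //; exact: measurable_cst.
by apply/funext => i; case: (b i).
Qed.

Lemma measurable_elem_score d (T : measurableType d) (a t x y : T -> R) :
  measurable_fun setT a -> measurable_fun setT t ->
  measurable_fun setT x -> measurable_fun setT y ->
  measurable_fun setT (fun i => elem_score (a i) (t i) (x i) (y i)).
Proof.
move=> ma mt mx my; rewrite /elem_score.
by apply: measurable_funM; apply: measurable_funB => //;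
  apply: measurable_natbool; exact: measurable_fun_ltr.
Qed.

Lemma is_interval_emeasurable (f : measurableTypeR R -> \bar R) :
  (forall c, is_interval [set x : R | (c <= f x)%E]) -> measurable_fun setT f.
Proof.
move=> If; apply: (measurability _ (ErealGenCInfty.measurableE R)) => //.
move=> _ [_ [c ->] <-]; rewrite setTI; apply: is_interval_measurable.
move=> x y /=; rewrite !in_itv/= !andbT => cx cy z xyz.
by rewrite in_itv/= andbT; exact: (If c%:E x y cx cy z xyz).
Qed.
End Score.

(** * Expected scores mixed over the level *)

Section IntegratedScore.
Context {R : realType}.
Variables (mu : {measure set (measurableTypeR R) -> \bar R})
  (D : set (measurableTypeR R)) (t x : measurableTypeR R -> R).
Hypotheses (mD : measurable D) (D01 : forall a, D a -> 0 < a < 1).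
Hypotheses (mt : measurable_fun setT t) (mx : measurable_fun setT x).

(* [t a] is the threshold and [x a] the reported quantile at level [a] *)
Let S (y : measurableTypeR R) : \bar R :=
  (\int[mu]_(a in D) (elem_score a (t a) (x a) y)%:E)%E.

(* the parts of the score that are nondecreasing, respectively nonincreasing,
   in the outcome [y] *)
Let up (y : R) a : R := if x a <= t a then a * (t a < y)%R%:R else 0.
Let dn (y : R) a : R := if x a <= t a then 0 else (1 - a) * (y <= t a)%R%:R.

Let mup y : measurable_fun setT (up y).
Proof.
apply: measurable_fun_ifT => //; first exact: measurable_fun_ler.
by apply: measurable_funM => //; apply/measurable_natbool/measurable_fun_ltr.
Qed.

Let mdn y : measurable_fun setT (dn y).
Proof.
apply: measurable_fun_ifT => //; first exact: measurable_fun_ler.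
apply: measurable_funM => //; first exact: measurable_funB.
by apply/measurable_natbool/measurable_fun_ler.
Qed.

Let up0 y a : D a -> 0 <= up y a.
Proof.
move=> /D01/andP[a0 _]; rewrite /up; case: ifP => // _.
by rewrite mulr_ge0// ltW.
Qed.

Let dn0 y a : D a -> 0 <= dn y a.
Proof.
move=> /D01/andP[_ a1]; rewrite /dn; case: ifP => // _.
by rewrite mulr_ge0// subr_ge0 ltW.
Qed.

(** As [mu] is arbitrary, measurability does not come from Tonelli's theorem but
from monotonicity in the outcome: the mixed score is the sum of a nondecreasing
and a nonincreasing function. *)
Lemma measurable_integrated_score : measurable_fun setT S.
Proof.
have mE (f : measurableTypeR R -> R) : measurable_fun setT f ->
    measurable_fun D (EFin \o f).
  by move=> mf; apply/measurable_EFinP; exact: measurable_funTS.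
rewrite (_ : S = fun y => \int[mu]_(a in D) (up y a)%:E +
                          \int[mu]_(a in D) (dn y a)%:E)%E; last first.
  apply/funext => y; rewrite -ge0_integralD//.
  - apply: eq_integral => a _; rewrite elem_scoreE /up /dn -EFinD.
    by case: ifP => _; rewrite ?addr0 ?add0r.
  - exact: up0.
  - exact: mE.
  - exact: dn0.
  - exact: mE.
have upS y z : y <= z -> (\int[mu]_(a in D) (up y a)%:E <=
                          \int[mu]_(a in D) (up z a)%:E)%E.
  move=> yz; apply: ge0_le_integral => //.
  - exact: up0.
  - exact: mE.
  - exact: mE.
  - move=> a /D01/andP[a0 _]; rewrite lee_fin /up; case: ifP => // _.
    rewrite ler_pM2l// ler_nat; have [ty|//] := ltP (t a) y.
    by rewrite (lt_le_trans ty yz).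
have dnS y z : y <= z -> (\int[mu]_(a in D) (dn z a)%:E <=
                          \int[mu]_(a in D) (dn y a)%:E)%E.
  move=> yz; apply: ge0_le_integral => //.
  - exact: dn0.
  - exact: mE.
  - exact: mE.
  - move=> a /D01/andP[_ a1]; rewrite lee_fin /dn; case: ifP => // _.
    rewrite ler_pM2l ?subr_gt0// ler_nat; have [zt|//] := leP z (t a).
    by rewrite (le_trans yz zt).
apply: emeasurable_funD; apply: is_interval_emeasurable => c u v /= cu cv w.
- by move=> /andP[uw _]; apply: le_trans cu (upS _ _ uw).
- by move=> /andP[_ wv]; apply: le_trans cv (dnS _ _ wv).
Qed.

Variables (F : distr R) (I : set (measurableTypeR R)).
Hypotheses (mI : measurable I) (FI : F I = 1%E).

Let FIC : F (~` I) = 0%E.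
Proof. by rewrite probability_setC// FI subee. Qed.

(** Finiteness of the expected mixed score allows the order of integration to
be exchanged for every measure [mu].  Let [Y0] be the set of outcomes with
finite mixed score, which has full measure.  At a fixed level the score is
nonzero on a half-line of outcomes, so that it is enough to look at a
countable subset of [Y0] that is cofinal and coinitial in it. *)
Lemma integrated_score_Fubini : (\int[F]_(y in I) S y < +oo ->
  \int[F]_(y in I) S y =
  \int[mu]_(a in D) \int[F]_(y in I) (elem_score a (t a) (x a) y)%:E)%E.
Proof.
move=> Soo.
have S0 y : (0 <= S y)%E.
  by apply: integral_ge0 => a /D01 a01; rewrite lee_fin elem_score_ge0.
have mSI : measurable_fun I S := measurable_funTS measurable_integrated_score.
pose N := I `&` [set y | S y = +oo%E].
have mN : measurable N.
  by apply: measurable_eqe.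
have FN : F N = 0%E.
  have iS : F.-integrable I S.
    apply/integrableP; split => //; apply: le_lt_trans Soo.
    by under eq_integral do rewrite gee0_abs//.
  apply: (negligibleP _ mN).1; apply: negligibleS (integrable_ae mI iS).
  by move=> y [Iy Sy] /(_ Iy); rewrite Sy.
pose Y0 := I `\` N.
have Y0E y : Y0 y <-> I y /\ (S y < +oo)%E.
  rewrite /Y0 /N /=; split => [[Iy nN]|[Iy Sy]].
    by split => //; rewrite ltey; apply/eqP => Sy; apply: nN.
  by split => // -[_ E]; move: Sy; rewrite E.
have Y00 : Y0 !=set0.
  apply/set0P/eqP => Y0_; suff : F I = 0%E by rewrite FI => /eqP; rewrite onee_eq0.
  apply: (subset_measure0 mI mN _ FN) => y Iy; apply: contrapT => nN.
  by suff : set0 y by []; rewrite -Y0_.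
have [v [vY vcof]] := countable_cofinal Y00.
have [w [wY wcoi]] := countable_coinitial Y00.
(* v and w interleaved *)
pose u n := if odd n then v n./2 else w n./2.
have uY n : Y0 (u n) by rewrite /u; case: ifP.
pose h (p : measurableTypeR R * measurableTypeR R) : \bar R :=
  (\1_D p.1 * \1_I p.2 * elem_score p.1 (t p.1) (x p.1) p.2)%:E.
have mh : measurable_fun setT h.
  apply/measurable_EFinP; apply: measurable_funM.
    by apply: measurable_funM; apply: measurableT_comp.
  apply: measurable_elem_score => //.
  - by apply: measurableT_comp.
  - by apply: measurableT_comp.
have h0 p : (0 <= h p)%E.
  rewrite lee_fin indicE; have [/set_mem Dp|nD] := boolP (p.1 \in D).
    by rewrite mulr_ge0// elem_score_ge0//; exact: D01.
  by rewrite !mul0r.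
have hD y : I y -> (\int[mu]_a h (a, y) = S y)%E.
  move=> Iy; rewrite [RHS]integral_mkcond; apply: eq_integral => a _.
  rewrite patchE /h/= !indicE (mem_set Iy) mulr1.
  by case: ifP => _; rewrite ?mul1r ?mul0r.
have hnI a y : ~ I y -> h (a, y) = 0%E.
  by move=> nI; rewrite /h/= [\1_I _]indicE memNset// mulr0 mul0r.
have hI a : D a -> (\int[F]_y h (a, y) =
    \int[F]_(y in I) (elem_score a (t a) (x a) y)%:E)%E.
  move=> Da; rewrite [RHS]integral_mkcond; apply: eq_integral => y _.
  rewrite patchE /h/= !indicE (mem_set Da) mul1r.
  by case: ifP => _; rewrite ?mul1r ?mul0r.
have hnD a y : ~ D a -> h (a, y) = 0%E.
  by move=> nI; rewrite /h/= indicE memNset// !mul0r.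
have HS : (fun y => \int[mu]_a h (a, y))%E = S \_ I.
  apply/funext => y; rewrite patchE; case: ifPn => [/set_mem/hD//|nI].
  apply: integral0_eq => a _; apply: hnI => Iy; move/negP: nI; apply.
  exact/mem_set.
transitivity (\int[F]_y \int[mu]_a h (a, y))%E.
  by rewrite integral_mkcond -HS.
rewrite (tonelli_countable (N := N) (u := u))//.
- rewrite [RHS]integral_mkcond; apply: eq_integral => a _.
  rewrite patchE; case: ifPn => [/set_mem/hI//|nD].
  apply: integral0_eq => y _; apply: hnD => Da; move/negP: nD; apply.
  exact/mem_set.
- by rewrite HS; apply/(measurable_restrictT _ _).1.
- by move=> n; have /Y0E[Iu] := uY n; rewrite hD.
move=> a y nN hay.
have Iy : I y by apply: contrapT => /(hnI a); move/eqP: hay.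
have Da : D a by apply: contrapT => /(hnD a y); move/eqP: hay.
have [a0 a1] := andP (D01 Da).
have hE z : I z -> h (a, z) = (elem_score a (t a) (x a) z)%:E.
  by move=> Iz; rewrite /h/= !indicE (mem_set Da) (mem_set Iz) !mul1r.
have Yy : Y0 y by split.
move: hay; rewrite (hE _ Iy) eqe elem_scoreE; case: ifPn => xt.
- have [ty _|_] := ltP (t a) y; last by rewrite mulr0 eqxx.
  have [n yn] := vcof _ Yy; exists n.*2.+1.
  rewrite /u /= odd_double /= uphalf_double; have [Iv _] := vY n.
  by rewrite hE// eqe elem_scoreE xt (lt_le_trans ty yn) mulr1 gt_eqF.
- have [yt _|_] := leP y (t a); last by rewrite mulr0 eqxx.
  have [n yn] := wcoi _ Yy; exists n.*2.
  rewrite /u /= odd_double /= doubleK; have [Iw _] := wY n.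
  by rewrite hE// eqe elem_scoreE (negbTE xt) (le_trans yn yt) mulr1 gt_eqF// subr_gt0.
Qed.

Lemma expected_elem_score a (s r : R) : 0 < a < 1 ->
  (\int[F]_(y in I) (elem_score a s r y)%:E =
   (if r <= s then a * (1 - fine (CDF F s)) else (1 - a) * fine (CDF F s))%:E)%E.
Proof.
move=> /andP[a0 a1].
have FsE : F `]-oo, s]%classic = (fine (CDF F s))%:E by rewrite fineK// CDF_fin_num.
have FIA A : measurable A -> F (A `&` I) = F A.
  move=> mA; rewrite -[in RHS](setUIDK A I) setIC setDE measureU0//.
  - exact: measurableI.
  - by apply: measurableI => //; exact: measurableC.
  - apply: (subset_measure0 _ (measurableC mI) _ FIC); last exact: subIsetr.
    by apply: measurableI => //; exact: measurableC.
under eq_integral do rewrite elem_scoreE.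
case: ifPn => rs.
- transitivity (\int[F]_(y in I)
      (a%:E * (\1_(`]s, +oo[%classic : set (measurableTypeR R)) y)%:E))%E.
    by apply: eq_integral => y _; rewrite -EFinM indicE mem_setE in_itv/= andbT.
  rewrite ge0_integralZl//; last 2 first.
  - by apply/measurable_EFinP; exact: measurable_funTS.
  - by rewrite lee_fin ltW.
  rewrite integral_indic// EFinM; congr (_ * _)%E.
  apply: etrans (FIA _ _) _ => //.
  by rewrite -setCitvl probability_setC// FsE EFinB.
- transitivity (\int[F]_(y in I)
      ((1 - a)%:E * (\1_(`]-oo, s]%classic : set (measurableTypeR R)) y)%:E))%E.
    by apply: eq_integral => y _; rewrite -EFinM indicE mem_setE in_itv/=.
  rewrite ge0_integralZl//; last 2 first.
  - by apply/measurable_EFinP; exact: measurable_funTS.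
  - by rewrite lee_fin subr_ge0 ltW.
  rewrite integral_indic// EFinM -FsE; congr (_ * _)%E.
  exact: FIA.
Qed.

End IntegratedScore.

(** * The generalized diagonal score *)

Section GeneralizedDiagonalScore.
Context {R : realType}.
Variables (I : interval R) (G : distr R).
Variable mu : {measure set (measurableTypeR R) -> \bar R}.
Implicit Types (F : distr R) (a : R).

(** The expectation under [F] of the elementary score at level [a], with
threshold the [a]-quantile of [G], of the report [quantile F' a]. *)
Definition risk F F' a : R :=
  let c := fine (CDF F (quantile G a)) in
  if quantile F' a <= quantile G a then a * (1 - c) else (1 - a) * c.

Lemma measurable_risk F F' : measurable_fun (cdf_range G) (risk F F').
Proof.
suff m01 : measurable_fun (`]0, 1[ : set (measurableTypeR R)) (risk F F').
  apply: measurable_funS m01 => //.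
  by move=> a /cdf_range_sub; rewrite /= in_itv.
have mc := measurable_CDF_quantile F G.
have mif (b : R -> bool) (f g : R -> R) :
    measurable_fun (`]0, 1[ : set (measurableTypeR R)) b ->
    measurable_fun (`]0, 1[ : set (measurableTypeR R)) f ->
    measurable_fun (`]0, 1[ : set (measurableTypeR R)) g ->
    measurable_fun (`]0, 1[ : set (measurableTypeR R))
      (fun a => if b a then f a else g a).
  move=> mb mf mg; apply: measurable_fun_if => //.
  - by apply: measurable_funS mf => //; exact: subIsetl.
  - by apply: measurable_funS mg => //; exact: subIsetl.
apply: mif.
- by apply: measurable_fun_ler; exact: measurable_quantile.
- by apply: measurable_funM => //; exact: measurable_funB.
- by apply: measurable_funM => //; exact: measurable_funB.
Qed.

Lemma risk_ge0 F F' a : 0 < a < 1 -> 0 <= risk F F' a.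
Proof.
move=> /andP[a0 a1]; rewrite /risk.
have c0 : 0 <= fine (CDF F (quantile G a)) by rewrite fine_ge0// cdf_ge0.
have c1 : fine (CDF F (quantile G a)) <= 1.
  by rewrite -lee_fin fineK ?CDF_fin_num// cdf_le1.
by case: ifP => _; rewrite mulr_ge0 ?subr_ge0// ltW.
Qed.

Lemma risk_min F F' a : 0 < a < 1 -> risk F F a <= risk F F' a.
Proof.
move=> a01; apply: elem_score_opt.
by rewrite quantile_le// -lee_fin fineK ?CDF_fin_num.
Qed.

(** For the outcome distribution [G] itself both kinds of report have the same
risk at the levels in [cdf_range G]. *)
Lemma risk_diag F a : cdf_range G a -> risk G F a = a * (1 - a).
Proof.
by move=> aG; rewrite /risk CDF_quantile//=; case: ifP => _ //; rewrite mulrC.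
Qed.

Lemma expected_GDS F F' : concentrated I F ->
  expected_score I (GDS G mu) F F' \is a fin_num ->
  expected_score I (GDS G mu) F F' =
  (\int[mu]_(a in cdf_range G) (risk F F' a)%:E)%E.
Proof.
move=> FI.
(* quantile functions are set to 0 outside ]0, 1[ to be measurable everywhere *)
have mq (H : distr R) :
    measurable_fun setT (quantile H \_ `]0, 1[ : measurableTypeR R -> R).
  by apply/(measurable_restrictT _ _).1 => //; exact: measurable_quantile.
have qE (H : distr R) a : cdf_range G a -> (quantile H \_ `]0, 1[) a = quantile H a.
  by move=> /cdf_range_sub a01; rewrite patchE mem_set//= in_itv.
have GDSE : GDS G mu F' = fun y => (\int[mu]_(a in cdf_range G)
    (elem_score a ((quantile G \_ `]0, 1[) a) ((quantile F' \_ `]0, 1[) a) y)%:E)%E.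
  by apply/funext => y; apply: eq_integral => a /set_mem aG; rewrite !qE.
rewrite /expected_score GDSE => fin.
rewrite (integrated_score_Fubini (measurable_cdf_range G) (@cdf_range_sub _ G)
  (mq G) (mq F') _ FI)//; last by rewrite ltey_eq fin.
apply: eq_integral => a /set_mem aG.
by rewrite (expected_elem_score _ FI)// ?(cdf_range_sub aG)// !qE.
Qed.

(** The score of [F] depends only on the levels at which the quantile of [F] is
at most that of [G]. *)
Lemma eq_GDS F F' : (forall a : R, 0 < a < 1 ->
    (quantile F a <= quantile G a <-> quantile F' a <= quantile G a)) ->
  GDS G mu F = GDS G mu F'.
Proof.
move=> FF'; apply/funext => y; apply: eq_integral => a /set_mem /cdf_range_sub a01.
rewrite !elem_scoreE; suff -> : (quantile F a <= quantile G a) =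
  (quantile F' a <= quantile G a) by [].
by apply/idP/idP => /(FF' a a01).
Qed.

Lemma not_strictly_proper S (P0 : set (distr R)) F F' : P0 F -> P0 F' ->
  F' <> F -> expected_score I S F F = expected_score I S F F' ->
  ~ strictly_proper_rule I S P0.
Proof. by move=> PF PF' neq eqS /(_ F F' PF PF')[_ [/(_ eqS)]]. Qed.

End GeneralizedDiagonalScore.

(** * Propriety and its failure to be strict *)

Theorem theorem2 (R : realType) (I : interval R) (G : distr R)
    (mu : {measure set (measurableTypeR R) -> \bar R})
    (P0 : set (distr R))
    (HG : concentrated I G)
    (* mu is a Borel measure on ]0, 1[, seen as a measure on the line *)
    (Hmu : mu (~` `]0%R, 1%R[) = 0%E)
    (HP0 : P0 `<=` concentrated I)
    (Hfin : forall F F' : distr R, P0 F -> P0 F' ->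
       expected_score I (GDS G mu) F F' \is a fin_num) :
  [/\ proper_rule I (GDS G mu) P0,
      (forall F : distr R, P0 G -> P0 F -> F <> G ->
         expected_score I (GDS G mu) G G = expected_score I (GDS G mu) G F /\
         ~ strictly_proper_rule I (GDS G mu) P0)
    & (forall F F' : distr R, P0 F -> P0 F' -> F <> F' ->
         (forall a : R, 0 < a < 1 ->
            (quantile F a <= quantile G a <-> quantile F' a <= quantile G a)) ->
         expected_score I (GDS G mu) F F = expected_score I (GDS G mu) F F' /\
         ~ strictly_proper_rule I (GDS G mu) P0)].
Proof.
have riskE F F' : P0 F -> P0 F' -> expected_score I (GDS G mu) F F' =
    (\int[mu]_(a in cdf_range G) (risk G F F' a)%:E)%E.
  by move=> PF PF'; apply: expected_GDS; [exact: HP0|exact: Hfin].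
split.
- move=> F F' PF PF'; rewrite !riskE//; apply: ge0_le_integral.
  + exact: measurable_cdf_range.
  + by move=> a /cdf_range_sub a01; rewrite lee_fin risk_ge0.
  + by apply/measurable_EFinP; exact: measurable_risk.
  + by apply/measurable_EFinP; exact: measurable_risk.
  + by move=> a /cdf_range_sub a01; rewrite lee_fin risk_min.
- move=> F PG PF FG.
  have eqGF : expected_score I (GDS G mu) G G = expected_score I (GDS G mu) G F.
    by rewrite !riskE//; apply: eq_integral => a /set_mem aG; rewrite !risk_diag.
  by split => //; exact: not_strictly_proper PG PF FG eqGF.
- move=> F F' PF PF' FF' qFF'.
  have eqFF' : expected_score I (GDS G mu) F F = expected_score I (GDS G mu) F F'.
    by rewrite /expected_score (eq_GDS mu qFF').
  by split => //; apply: not_strictly_proper PF PF' _ eqFF' => /esym.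
Qed.
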